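(* Let $d>2$ be a real number and let $G$ be a finitely generated group that has a central element of infinite order and satisfies condition $S_d$. Then each nonzero class in $H^1(G,L^2(G))$ can be represented by a function from $L^{\frac{2d}{d-2}}(G)$; that is, under the identification $H^1(G,L^2(G))\cong D^2(G)/(L^2(G)\oplus\mathbb{C})$, every nonzero class is the class of some $\alpha\in D^2(G)\cap L^{\frac{2d}{d-2}}(G)$.
   Context: Fix a finite symmetric generating set $S$ of $G$ ($S=S^{-1}$). For a real number $p\ge 1$, $L^p(G)$ is the space of functions $\alpha:G\to\mathbb{C}$ with $\|\alpha\|_p=(\sum_{x\in G}|\alpha(x)|^p)^{1/p}<\infty$. For $\beta:G\to\mathbb{C}$ and $g\in G$ write $(\beta*(g-1))(x)=\beta(xg^{-1})-\beta(x)$. $D^p(G)$ is the space of functions $\beta:G\to\mathbb{C}$ with $\beta*(g-1)\in L^p(G)$ for all $g\in S$, and $\|\beta\|_{D(p)}=(\sum_{g\in S}\|\beta*(g-1)\|_p^p)^{1/p}$. $\mathbb{C}G$ is the group ring, viewed as the finitely supported functions $G\to\mathbb{C}$. For $d>1$, $G$ satisfies condition $S_d$ if there is a constant $C>0$ such that $\|\alpha\|_{\frac{d}{d-1}}\le C\|\alpha\|_{D(1)}$ for all $\alpha\in\mathbb{C}G$. $H^1(G,L^2(G))=Z^1/B^1$ is the first cohomology group of $G$ with coefficients in $L^2(G)$, with $G$ acting on the right by right translation $\alpha_g(x)=\alpha(xg^{-1})$: $Z^1$ consists of the maps $\delta:G\to L^2(G)$ with $\delta(gh)=(\delta(g))_h+\delta(h)$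 and $B^1$ of the maps $\delta(g)=\alpha_g-\alpha$ with $\alpha\in L^2(G)$. Sending $\beta\in D^2(G)$ to the cocycle $g\mapsto\beta*(g-1)$ induces the isomorphism $D^2(G)/(L^2(G)\oplus\mathbb{C})\cong H^1(G,L^2(G))$, where $\mathbb{C}$ denotes the constant functions. *)

(* Defs.v *)
From HB Require Import structures.
From mathcomp Require Import all_boot all_order all_algebra.
From mathcomp Require Import finmap.
From mathcomp Require Import all_classical all_reals all_analysis.
From mathcomp Require Import complex.

Set Implicit Arguments.
Unset Strict Implicit.
Unset Printing Implicit Defensive.

Import Order.TTheory GRing.Theory Num.Theory.
Import ComplexField.Normc.

Local Open Scope classical_set_scope.
Local Open Scope ring_scope.
Local Open Scope complex_scope.

Section Group.
Variable G : groupType.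

Definition symmetric_fset (S : {fset G}) : Prop :=
  forall g, g \in S -> (g^-1)%g \in S.

Definition generates (S : {fset G}) : Prop :=
  forall H : {pred G}, group_closed H -> {subset S <= H} -> forall x, x \in H.

Definition central (z : G) : Prop := forall g : G, commute z g.

Definition infinite_order (z : G) : Prop :=
  forall n : nat, (0 < n)%N -> (z ^+ n)%g <> 1%g.

End Group.

Section Spaces.
Variables (R : realType) (G : groupType).

(* [normc] is the modulus with values in [R]; the ring notation for the norm
   on [R[i]] takes its values in [R[i]]. *)
Definition lpnorm (p : R) (a : G -> R[i]) : \bar R :=
  ((\esum_(x in [set: G]) (normc (a x) `^ p)%:E) `^ p^-1)%E.

Definition Lp (p : R) : set (G -> R[i]) := [set a | (lpnorm p a < +oo)%E].

Definition rtrans (g : G) (a : G -> R[i]) : G -> R[i] :=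
  fun x => a (x * g^-1)%g.

(* b * (g - 1) *)
Definition rdiff (b : G -> R[i]) (g : G) : G -> R[i] :=
  fun x => rtrans g b x - b x.

Definition Dp (S : {fset G}) (p : R) : set (G -> R[i]) :=
  [set b | forall g, g \in S -> Lp p (rdiff b g)].

Definition dpnorm (S : {fset G}) (p : R) (b : G -> R[i]) : \bar R :=
  ((\sum_(g <- S) lpnorm p (rdiff b g) `^ p) `^ p^-1)%E.

Definition group_ring : set (G -> R[i]) :=
  [set a | finite_set [set x | a x != 0]].

Definition condition_S (S : {fset G}) (d : R) : Prop :=
  exists2 C : R, 0 < C &
    forall a, group_ring a ->
      (lpnorm (d / (d - 1)) a <= C%:E * dpnorm S 1 a)%E.

Definition Z1 : set (G -> G -> R[i]) :=
  [set delta | (forall g, Lp 2 (delta g)) /\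
    forall g h x, delta (g * h)%g x = rtrans h (delta g) x + delta h x].

Definition B1 : set (G -> G -> R[i]) :=
  [set delta | exists2 a, Lp 2 a & forall g x, delta g x = rdiff a g x].

(* The coset delta + B1; the quotient Z1 / B1 is the set of these cosets, and
   its zero element is the coset B1 itself. *)
Definition coh_class (delta : G -> G -> R[i]) : set (G -> G -> R[i]) :=
  [set eps | B1 (fun g x => eps g x - delta g x)].

Definition H1 : set (set (G -> G -> R[i])) := coh_class @` Z1.

(* The class of b under D^2 / (L^2 + C) ~= H^1(G, L^2); [rdiff b] is the
   cocycle g |-> b * (g - 1). *)
Definition H1_of_D2 (b : G -> R[i]) : set (G -> G -> R[i]) :=
  coh_class (rdiff b).

End Spaces.

Arguments B1 R G : clear implicits.
Arguments H1 R G : clear implicits.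

(* Main.v *)
(* Write [b] for a function with [b * (g - 1) = delta g].  For a central element
   [z] of infinite order, [b] minus its average over the translates by
   [z ^ k], [k < n], lies in L^2, and its D(2)-distance to [b] is controlled by
   the averages of [delta g], which tend to 0 in L^2 by the mean ergodic theorem,
   [z] having no nonzero invariant vector in L^2.  So [b] is a D(2)-limit of
   finitely supported functions [a_n].  Applying S_d to [|a| ^ (2(d-1)/(d-2))]
   and Cauchy-Schwarz gives the Sobolev inequality
   [||a||_(2d/(d-2)) <= K ||a||_D(2)] for finitely supported [a].  Hence [a_n] is
   Cauchy in L^(2d/(d-2)), and its limit differs from [b] by a constant. *)

Require Import Defs.
From HB Require Import structures.
From mathcomp Require Import all_boot all_order all_algebra.
From mathcomp Require Import finmap.
From mathcomp Require Import all_classical all_reals all_analysis.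
From mathcomp Require Import complex.
From mathcomp Require Import ring lra.

Set Implicit Arguments.
Unset Strict Implicit.
Unset Printing Implicit Defensive.

Import Order.TTheory GRing.Theory Num.Theory.
Import ComplexField.Normc.

Local Open Scope ring_scope.

(** * The modulus on the complex numbers, with real values *)

Section Modulus.
Variable R : realType.
Implicit Types x y : R[i].

Lemma normc_ge0 x : 0 <= normc x.
Proof. by case: x => a b; exact: sqrtr_ge0. Qed.

Lemma ler_normcD x y : normc (x + y) <= normc x + normc y.
Proof. exact: (@le_normcD R x y). Qed.

Lemma normc_opp x : normc (- x) = normc x.
Proof. exact: (@normcN R x). Qed.

Lemma normc_nat n : normc (n%:R : R[i]) = n%:R.
Proof. by rewrite (@normcMn R 1 n) normc1. Qed.

Lemma normc_distC x y : normc (x - y) = normc (y - x).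
Proof. by rewrite -normc_opp opprB. Qed.

Lemma ler_dist_normc x y : `|normc x - normc y| <= normc (x - y).
Proof.
have h (u v : R[i]) : normc u - normc v <= normc (u - v).
  by rewrite lerBlDr; have := ler_normcD (u - v) v; rewrite subrK.
by rewrite ler_norml h andbT lerNl opprB normc_distC h.
Qed.

Lemma normc_realc (x : R) : normc (x%:C)%C = `|x|.
Proof. by rewrite /= expr0n /= addr0 sqrtr_sqr. Qed.

Lemma ler_normc_sum (I : Type) (s : seq I) (F : I -> R[i]) :
  normc (\sum_(i <- s) F i) <= \sum_(i <- s) normc (F i).
Proof.
elim: s => [|i s IH]; first by rewrite !big_nil normc0.
by rewrite !big_cons (le_trans (ler_normcD _ _)) ?lerD2l.
Qed.

End Modulus.

(** * Bounds on sums over a possibly infinite index type, through finite subsums *)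

Section FiniteSums.
Variables (R : realType) (T : choiceType).
Implicit Types (f g : T -> R) (s : seq T).

(** For nonnegative [f] this is equivalent to [\esum f <= M], phrased so that all estimates stay in
    [R]. *)
Definition sums_le f (M : R) := forall s, uniq s -> \sum_(x <- s) f x <= M.

(** For [0 <= e] this is the bound ||f||_2 <= e, squared to avoid roots. *)
Definition l2_le f (e : R) := sums_le (fun x => f x ^+ 2) (e ^+ 2).

Lemma sums_le_ge0 f M : sums_le f M -> 0 <= M.
Proof. by move=> /(_ [::] isT); rewrite big_nil. Qed.

Lemma sums_le_inj (U : choiceType) (h : U -> T) f M :
  injective h -> sums_le f M -> forall s : seq U, uniq s ->
  \sum_(x <- s) f (h x) <= M.
Proof.
by move=> hI fM s us; rewrite -(big_map h predT f) fM ?map_inj_uniq.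
Qed.

Lemma sums_leS f g M : (forall x, f x <= g x) -> sums_le g M -> sums_le f M.
Proof. by move=> fg gM s /gM; apply/le_trans/ler_sum. Qed.

Lemma sums_le_point f M x : sums_le f M -> f x <= M.
Proof. by move=> /(_ [:: x] isT); rewrite big_seq1. Qed.

Lemma sum_sqr_ge0 s f : 0 <= \sum_(x <- s) f x ^+ 2.
Proof. by apply: sumr_ge0 => x _; exact: sqr_ge0. Qed.

(** Induction on [s]: with A^2 <= BC for the tail, the new cross term satisfies 2abA <= a^2 C + b^2
    B by the arithmetic-geometric mean inequality. *)
Lemma CauchySchwarz_seq s f g :
  (\sum_(x <- s) f x * g x) ^+ 2 <=
  (\sum_(x <- s) f x ^+ 2) * (\sum_(x <- s) g x ^+ 2).
Proof.
elim: s => [|x s]; first by rewrite !big_nil expr0n mulr0.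
rewrite !big_cons; have := sum_sqr_ge0 s f; have := sum_sqr_ge0 s g.
move: (\sum_(y <- s) f y * g y) (f x) (g x) => A a b.
move: (\sum_(y <- s) f y ^+ 2) (\sum_(y <- s) g y ^+ 2) => B C C0 B0 ABC.
suff : 2 * (a * b) * A <= a ^+ 2 * C + b ^+ 2 * B by nra.
have P0 : 0 <= a ^+ 2 * C + b ^+ 2 * B.
  by apply: addr_ge0; apply: mulr_ge0 => //; exact: sqr_ge0.
(* Both sides are compared after squaring: (2abA)^2 <= 4 a^2 b^2 BC <= (a^2 C + b^2 B)^2. *)
have AP : (2 * (a * b) * A) ^+ 2 <= (a ^+ 2 * C + b ^+ 2 * B) ^+ 2.
  have : 0 <= (a ^+ 2 * C - b ^+ 2 * B) ^+ 2 by rewrite sqr_ge0.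
  have : 0 <= (a * b) ^+ 2 * (B * C - A ^+ 2).
    by rewrite mulr_ge0 ?sqr_ge0 ?subr_ge0.
  by move=> h1 h2; nra.
by rewrite leNgt; apply/negP => h; nra.
Qed.

Lemma l2_le_mul f g (e1 e2 : R) s : 0 <= e1 -> 0 <= e2 ->
  \sum_(x <- s) f x ^+ 2 <= e1 ^+ 2 -> \sum_(x <- s) g x ^+ 2 <= e2 ^+ 2 ->
  \sum_(x <- s) f x * g x <= e1 * e2.
Proof.
move=> e10 e20 fe ge; have := CauchySchwarz_seq s f g.
have F0 := sum_sqr_ge0 s f.
have G0 := sum_sqr_ge0 s g.
move=> h; have {h} : (\sum_(x <- s) f x * g x) ^+ 2 <= (e1 * e2) ^+ 2.
  by rewrite (le_trans h)// exprMn ler_pM.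
have := mulr_ge0 e10 e20; rewrite leNgt => *; apply/negP => *; nra.
Qed.

Lemma l2_leD f g (e1 e2 : R) : 0 <= e1 -> 0 <= e2 ->
  l2_le f e1 -> l2_le g e2 -> l2_le (fun x => f x + g x) (e1 + e2).
Proof.
move=> e10 e20 fe ge s us.
have := l2_le_mul e10 e20 (fe s us) (ge s us); have := fe s us; have := ge s us.
have -> : \sum_(x <- s) (f x + g x) ^+ 2 = \sum_(x <- s) f x ^+ 2 +
    (\sum_(x <- s) f x * g x) *+ 2 + \sum_(x <- s) g x ^+ 2.
  by rewrite -sumrMnl -!big_split; apply: eq_bigr => x _; rewrite sqrrD.
by move=> *; lra.
Qed.

Lemma l2_leS f g e : (forall x, 0 <= f x <= g x) -> l2_le g e -> l2_le f e.
Proof.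
move=> fg; apply: sums_leS => x; have /andP[f0 fgx] := fg x.
by rewrite lerXn2r ?nnegrE ?(le_trans f0).
Qed.

Lemma l2_le_trans f (e1 e2 : R) : 0 <= e1 -> e1 <= e2 ->
  l2_le f e1 -> l2_le f e2.
Proof.
move=> e10 e12 fe s us; rewrite (le_trans (fe s us)) ?lerXn2r ?nnegrE//.
exact: le_trans e12.
Qed.

Lemma l2_leZ f e (c : R) : l2_le f e -> l2_le (fun x => c * f x) (c * e).
Proof.
move=> fe s us; under eq_bigr do rewrite exprMn.
by rewrite -mulr_sumr exprMn ler_wpM2l ?sqr_ge0 ?fe.
Qed.

Lemma l2_le_point f e x : 0 <= e -> l2_le f e -> f x <= e.
Proof. move=> e0 /(@sums_le_point _ _ x) h; rewrite leNgt; apply/negP; nra. Qed.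

Lemma sums_le_l2 f M : sums_le (fun x => f x ^+ 2) M -> l2_le f (Num.sqrt M).
Proof. by move=> fM; rewrite /l2_le sqr_sqrtr ?(sums_le_ge0 fM). Qed.

Lemma sums_le_supp f s : uniq s -> (forall x, 0 <= f x) ->
  (forall x, x \notin s -> f x = 0) -> sums_le f (\sum_(x <- s) f x).
Proof.
move=> us f0 fs t ut; rewrite (bigID (mem s)) /= [X in _ + X]big1 ?addr0//.
rewrite -big_filter (perm_big [seq x <- s | x \in t]); last first.
  by apply: uniq_perm; rewrite ?filter_uniq// => x; rewrite !mem_filter andbC.
by rewrite big_filter [leRHS](bigID (mem t)) /= lerDl sumr_ge0.
Qed.

(** Take [s0] whose sum is within [eta] of the supremum of all finite sums. A finite sum outside
    [s0], added to that of [s0], still cannot exceed the supremum, so it is at most [eta]. *)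
Lemma sums_tail f M (eta : R) : 0 < eta -> sums_le f M ->
  exists2 s0, uniq s0 &
    sums_le (fun x => if x \in s0 then 0 else f x) eta.
Proof.
move=> eta0 fM.
pose E := [set \sum_(x <- s) f x | s in [set s | uniq s]]%classic.
have supE : has_sup E.
  split; first by exists (\sum_(x <- [::]) f x), [::].
  by exists M => _ [s us <-]; apply: fM.
have [? [s0 us0 <-] lts0] := sup_adherent eta0 supE.
exists s0 => // s us.
rewrite (bigID (mem s0)) /= big1 ?add0r; last by move=> x ->.
have -> : \sum_(x <- s | x \notin s0) (if x \in s0 then 0 else f x) =
    \sum_(x <- [seq y <- s | y \notin s0]) f x.
  by rewrite big_filter; apply: eq_bigr => x /negPf->.
set s1 := [seq x <- s | _].
have /(sup_upper_bound supE) : E (\sum_(x <- s0 ++ s1) f x).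
  exists (s0 ++ s1) => //=; rewrite cat_uniq us0 filter_uniq//= andbT.
  by apply/hasPn => x; rewrite mem_filter => /andP[].
by rewrite big_cat /=; move: lts0; lra.
Qed.

End FiniteSums.

(** * Finite-sum bounds against extended-real sums *)

Section Bridge.
Variables (R : realType) (T : choiceType).

Lemma esum_le (f : T -> R) M : (forall x, 0 <= f x) -> sums_le f M ->
  (\esum_(x in [set: T]) (f x)%:E <= M%:E)%E.
Proof.
move=> f0 fM; apply: ge_ereal_sup => _ [A [finA _] <-].
by rewrite fsbig_finite//= sumEFin lee_fin fM// fset_uniq.
Qed.

Lemma seq_le_esum (f : T -> R) (s : seq T) : uniq s ->
  ((\sum_(x <- s) f x)%:E <= \esum_(x in [set: T]) (f x)%:E)%E.
Proof.
move=> us; apply: esum_ge; exists [set` s]%classic.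
  by split => //; exact: finite_seq.
by rewrite -fsbig_seq// sumEFin.
Qed.

End Bridge.

(** * Membership in L^p and L^2 in terms of finite-sum bounds *)

Section LpBridge.
Variables (R : realType) (G : groupType).
Implicit Types a : G -> R[i].

Lemma lpnorm_le p a M : 0 < p -> sums_le (fun x => normc (a x) `^ p) M ->
  (lpnorm p a <= (M `^ p^-1)%:E)%E.
Proof.
move=> p0 aM; have M0 := sums_le_ge0 aM.
have h0 x : 0 <= normc (a x) `^ p by exact: powR_ge0.
rewrite /lpnorm -poweR_EFin gt0_ler_poweR ?invr_ge0 ?(ltW p0)//.
- by rewrite in_itv /= leey andbT esum_ge0// => x _; rewrite lee_fin.
- by rewrite in_itv /= leey andbT lee_fin.
- exact: esum_le.
Qed.

Lemma seq_le_lpnorm p a (s : seq G) : 0 < p -> uniq s ->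
  (((\sum_(x <- s) normc (a x) `^ p) `^ p^-1)%:E <= lpnorm p a)%E.
Proof.
move=> p0 us; have h0 x : 0 <= normc (a x) `^ p by exact: powR_ge0.
rewrite /lpnorm -poweR_EFin gt0_ler_poweR ?invr_ge0 ?(ltW p0)//.
- by rewrite in_itv /= leey andbT lee_fin sumr_ge0.
- by rewrite in_itv /= leey andbT esum_ge0// => x _; rewrite lee_fin.
- exact: seq_le_esum.
Qed.

Lemma LpP p a : 0 < p ->
  Lp p a <-> exists M, sums_le (fun x => normc (a x) `^ p) M.
Proof.
move=> p0; split => [|[M aM]].
  rewrite /Lp /= /lpnorm => /lty_poweRy; rewrite invr_eq0 gt_eqF// => /(_ isT).
  set E := (\esum_(_ in _) _)%E => Elt.
  have E0 : (0 <= E)%E by apply: esum_ge0 => x _; rewrite lee_fin powR_ge0.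
  exists (fine E) => s us; rewrite -lee_fin fineK ?ge0_fin_numE//.
  exact: seq_le_esum.
by rewrite /Lp /= (le_lt_trans (lpnorm_le p0 aM)) ?ltry.
Qed.

Lemma L2P a : Lp 2 a <-> exists2 e, 0 <= e & l2_le (fun x => normc (a x)) e.
Proof.
rewrite LpP//; split => [[M aM]|[e e0 ae]].
  exists (Num.sqrt M); rewrite ?sqrtr_ge0//; apply: sums_le_l2.
  by apply: sums_leS aM => x; rewrite powR_mulrn// normc_ge0.
exists (e ^+ 2); apply: sums_leS ae => x.
by rewrite powR_mulrn// normc_ge0.
Qed.

End LpBridge.

(** * The mean ergodic theorem for translation by an element of infinite order *)

Section MeanErgodic.
Variables (R : realType) (G : groupType) (z : G).
Hypothesis z_inf : infinite_order z.
Implicit Types a : G -> R[i].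

Lemma expg_infinite_inj : injective (fun n : nat => (z ^+ n)%g).
Proof.
have h j k : (z ^+ j = z ^+ (j + k))%g -> k = 0%N.
  case: k => // k; rewrite expgnDr -{1}[(z ^+ j)%g]mulg1 => /mulgI.
  by move/esym/z_inf => /(_ isT).
move=> j k /= jk; case: (leqP j k) => [|/ltnW] /subnKC e.
  by move: jk; rewrite -e => /h ->; rewrite addn0.
by move/esym: jk; rewrite -e => /h ->; rewrite addn0.
Qed.

Lemma l2_le_rtrans a g e : l2_le (fun x => normc (a x)) e ->
  l2_le (fun x => normc (rtrans g a x)) e.
Proof.
move=> ae s; apply: (sums_le_inj (h := fun x => (x * g^-1)%g) _ ae).
exact: mulIg.
Qed.

(** The triangle inequality: translates keep the L^2 norm. The linear growth in [n] is good enough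
    for a small tail. *)
Lemma l2_le_orbit_sum a e n : 0 <= e -> l2_le (fun x => normc (a x)) e ->
  l2_le (fun x => normc (\sum_(k < n) rtrans (z ^+ k)%g a x)) (n%:R * e).
Proof.
move=> e0 ae; elim: n => [|n IH].
  by move=> s us; rewrite big1 ?sqr_ge0// => x _; rewrite big_ord0 normc0 expr0n.
rewrite -addn1 natrD mulrDl mul1r addn1.
apply: l2_leS (l2_leD _ e0 IH (l2_le_rtrans (z ^+ n)%g ae)).
  by move=> x; rewrite normc_ge0 big_ord_recr ler_normcD.
by rewrite mulr_ge0.
Qed.

(** For summable [a] the L^2 norm of the orbit sum grows only like the square root of [n]. The
    points x z^(-k) are distinct, so the sum is bounded by [B] pointwise; its L^1 norm is at most
    nB; and ||.||_2^2 is at most the product of these two bounds. *)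
Lemma l1_orbit_sum a B n : sums_le (fun x => normc (a x)) B ->
  sums_le (fun x => normc (\sum_(k < n) rtrans (z ^+ k)%g a x) ^+ 2)
    (n%:R * B ^+ 2).
Proof.
move=> aB; have B0 := sums_le_ge0 aB.
have supB x : normc (\sum_(k < n) rtrans (z ^+ k)%g a x) <= B.
  rewrite (le_trans (ler_normc_sum _ _))//.
  apply: (sums_le_inj (h := fun k : 'I_n => (x * (z ^+ k)^-1)%g) _ aB).
    by move=> j k /mulgI /invg_inj /expg_infinite_inj /val_inj.
  exact: index_enum_uniq.
move=> s us; apply: (@le_trans _ _
    (\sum_(x <- s) B * \sum_(k < n) normc (rtrans (z ^+ k)%g a x))).
  apply: ler_sum => x _; rewrite expr2 ler_pM ?normc_ge0//.
  exact: ler_normc_sum.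
rewrite -mulr_sumr exchange_big /= expr2 mulrCA ler_wpM2l//.
rewrite -[n in n%:R](card_ord n) mulr_natl -sumr_const ler_sum// => k _.
apply: (sums_le_inj (h := fun x => (x * (z ^+ k)^-1)%g) _ aB) => //.
exact: mulIg.
Qed.

Lemma L2_truncation a M eps : 0 < eps ->
  sums_le (fun x => normc (a x) ^+ 2) M ->
  exists2 s, uniq s &
    l2_le (fun x => normc (a x - (if x \in s then a x else 0))) eps.
Proof.
move=> eps0 aM; have e20 : 0 < eps ^+ 2 by rewrite exprn_gt0.
have [s us h] := sums_tail e20 aM; exists s => //.
by apply: sums_leS h => x; case: ifP => _; rewrite ?subr0 ?subrr ?normc0 ?expr0n.
Qed.

(** The unnormalised form of the convergence of averages to 0. Split [a] into a finitely supported
    part [r] and a tail of norm at most eps/2: the tail contributes at most n eps/2, and [r] only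
    O(sqrt n). *)
Lemma mean_ergodic a M eps : 0 < eps ->
  sums_le (fun x => normc (a x) ^+ 2) M ->
  exists n0, forall n, (n0 <= n)%N ->
    l2_le (fun x => normc (\sum_(k < n) rtrans (z ^+ k)%g a x)) (n%:R * eps).
Proof.
move=> eps0 aM; have e20 : 0 < eps / 2 by rewrite divr_gt0.
have [s us tl] := L2_truncation e20 aM.
pose r x := if x \in s then a x else 0.
pose B := \sum_(x <- s) normc (a x).
have rB : sums_le (fun x => normc (r x)) B.
  have -> : B = \sum_(x <- s) normc (r x).
    by apply: eq_big_seq => x xs; rewrite /r xs.
  apply: sums_le_supp => // [x|x /negPf xs]; first exact: normc_ge0.
  by rewrite /r xs normc0.
(* Beyond this threshold n B^2 <= (n eps/2)^2, so the contribution of [r] is also at most n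
   eps/2. *)
exists (Num.truncn ((B / (eps / 2)) ^+ 2)).+1 => n n0n.
have nB : (B / (eps / 2)) ^+ 2 <= n%:R.
  by rewrite ltW// (lt_le_trans (truncnS_gt _))// ler_nat.
have -> : n%:R * eps = n%:R * (eps / 2) + n%:R * (eps / 2) by field.
have h1 := l2_le_orbit_sum n (ltW e20) tl.
have h2 : l2_le (fun x => normc (\sum_(k < n) rtrans (z ^+ k)%g r x))
    (n%:R * (eps / 2)).
  move=> t ut; rewrite (le_trans (l1_orbit_sum n rB ut))//.
  rewrite exprMn [n%:R ^+ 2]expr2 -mulrA ler_wpM2l// -ler_pdivrMr ?exprn_gt0//.
  by rewrite -expr_div_n.
have ne0 : 0 <= n%:R * (eps / 2) by rewrite mulr_ge0// ltW.
apply: l2_leS (l2_leD ne0 ne0 h1 h2).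
move=> x; rewrite normc_ge0/= (le_trans _ (ler_normcD _ _))//.
rewrite -big_split /= le_eqVlt; apply/orP; left; apply/eqP; congr normc.
by apply: eq_bigr => k _; rewrite /rtrans /r subrK.
Qed.

End MeanErgodic.

(** * The Sobolev inequality derived from condition S_d *)

Section Sobolev.
Variable R : realType.

(* From Young's inequality with exponents [r] and [r / (r - 1)]. *)
Lemma powR_tangent (a b r : R) : 1 < r -> 0 <= a -> 0 <= b ->
  a `^ r - b `^ r <= r * a `^ (r - 1) * (a - b).
Proof.
move=> r1 a0 b0.
have r0 : 0 < r by rewrite (lt_trans _ r1).
have r10 : 0 < r - 1 by rewrite subr_gt0.
have rn0 : r != 0 by rewrite gt_eqF.
have rn1 : r - 1 != 0 by rewrite gt_eqF.
have := @conjugate_powR R b (a `^ (r - 1)) r (r / (r - 1)) b0 (powR_ge0 _ _) r0.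
rewrite divr_gt0// => /(_ isT).
rewrite -powRrM [(r - 1) * _]mulrC divfK//.
have -> : r^-1 + (r / (r - 1))^-1 = 1 by field; rewrite ?rn0 ?rn1.
move=> /(_ erefl); rewrite -(ler_pM2l r0).
have -> : r * (b `^ r / r + a `^ r / (r / (r - 1))) =
    b `^ r + (r - 1) * a `^ r by field; rewrite ?rn0 ?rn1.
have := mulr_powRB1 a0 r0; move: (a `^ (r - 1)) (a `^ r) (b `^ r) => A P Q <-.
by move=> h; lra.
Qed.

(** The tangent inequality used in both directions, with the other power added to make the bound
    symmetric. *)
Lemma powR_dist (a b r : R) : 1 < r -> 0 <= a -> 0 <= b ->
  `|a `^ r - b `^ r| <= r * ((a `^ (r - 1) + b `^ (r - 1)) * `|a - b|).
Proof.
move=> r1; have r0 : 0 < r by rewrite (lt_trans _ r1).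
have h x y : 0 <= x -> 0 <= y ->
    x `^ r - y `^ r <= r * ((x `^ (r - 1) + y `^ (r - 1)) * `|x - y|).
  move=> x0 y0; rewrite (le_trans (powR_tangent r1 x0 y0))// -mulrA ler_pM2l//.
  apply: (@le_trans _ _ (x `^ (r - 1) * `|x - y|)).
    by rewrite ler_wpM2l ?powR_ge0 ?ler_norm.
  by rewrite ler_wpM2r// lerDl powR_ge0.
move=> a0 b0; rewrite ler_norml h// andbT lerNl opprB.
by rewrite distrC [a `^ (r - 1) + _]addrC h.
Qed.

(** S_d is applied to [b] = |a|^r. With N the sum of |a|^q, its left side is N^((d-1)/d), while
    Cauchy-Schwarz bounds the D(1)-norm of [b] by a multiple of sqrt(N) e. Dividing by sqrt(N)
    leaves N^(1/q), the L^q norm of [a]. *)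
Lemma Sobolev (G : groupType) (S : {fset G}) (d : R) : 2 < d ->
  condition_S S d ->
  exists2 K : R, 0 <= K & forall a (e : R), group_ring a -> 0 <= e ->
    (forall g, g \in S -> l2_le (fun x => normc (rdiff a g x)) e) ->
    sums_le (fun x => normc (a x) `^ (2 * d / (d - 2)))
      ((K * e) `^ (2 * d / (d - 2))).
Proof.
move=> d2 [C C0 hC].
(* The exponents satisfy r = 2(d-1)/(d-2), r d/(d-1) = q and 2s = q: the first power is the one for
   S_d, and |a|^s = |a|^(r-1) has squared L^2 norm N. *)
pose q := 2 * d / (d - 2); pose s := d / (d - 2); pose r := s + 1.
have d20 : 0 < d - 2 by rewrite subr_gt0.
have d0 : 0 < d by rewrite (lt_trans _ d2).
have d10 : 0 < d - 1 by lra.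
have dn : [/\ d - 2 != 0, d != 0 & d - 1 != 0] by rewrite !gt_eqF.
have [dn2 dn0 dn1] := dn.
have s0 : 0 < s by rewrite divr_gt0.
have r0 : 0 < r by rewrite addr_gt0.
have q0 : 0 < q by rewrite divr_gt0// mulr_gt0.
pose L : R := \sum_(g <- S) 1.
have L0 : 0 <= L by apply: sumr_ge0.
(* [C] comes from S_d, [L] counts the generators, [r] comes from [powR_dist], and 2 from its two
   terms, one at x and one at the translated point. *)
exists (C * L * (r * 2)); first by rewrite !mulr_ge0 ?(ltW C0) ?(ltW r0).
move=> a e fa e0 ae; rewrite -/q.
pose u x := normc (a x); have u0 x : 0 <= u x by exact: normc_ge0.
pose s1 : seq G := fset_set [set x | a x != 0]%classic.
have us1 : uniq s1 by exact: fset_uniq.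
have as1 x : x \notin s1 -> a x = 0.
  rewrite in_fset_set// => /negP h; apply/eqP; apply/negPn/negP => ax.
  by apply: h; rewrite inE.
pose N := \sum_(x <- s1) u x `^ q.
have uN : sums_le (fun x => u x `^ q) N.
  apply: sums_le_supp => // [x|x /as1 ax]; first exact: powR_ge0.
  by rewrite /u ax normc0 powR0 ?gt_eqF.
have N0 := sums_le_ge0 uN.
suff Nle : N <= (C * L * (r * 2) * e) `^ q.
  by move=> t /uN h; exact: le_trans h Nle.
pose b x : R[i] := (u x `^ r)%:C%C.
have nb x : normc (b x) = u x `^ r by rewrite normc_realc ger0_norm ?powR_ge0.
have fb : group_ring b.
  apply: sub_finite_set fa => x /=; apply: contraNN => /eqP ax.
  by apply/eqP; rewrite /b /u ax normc0 powR0 ?gt_eqF.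
pose w x := u x `^ s.
have wN : l2_le w (Num.sqrt N).
  apply: sums_le_l2; apply: sums_leS uN => x.
  by rewrite -powR_mulrn ?powR_ge0// -powRrM /q /s mulrC mulrA.
have gradb g : g \in S ->
    sums_le (fun x => normc (rdiff b g x) `^ 1) (r * 2 * Num.sqrt N * e).
  move=> gS t ut; pose v x := normc (rdiff a g x).
  have wgN : \sum_(x <- t) w (x * g^-1)%g ^+ 2 <= Num.sqrt N ^+ 2.
    by apply: (sums_le_inj (h := fun x => (x * g^-1)%g) _ wN) => //; exact: mulIg.
  have h1 := l2_le_mul (sqrtr_ge0 N) e0 wgN (ae g gS t ut).
  have h2 := l2_le_mul (sqrtr_ge0 N) e0 (wN t ut) (ae g gS t ut).
  apply: (@le_trans _ _
      (r * \sum_(x <- t) (w (x * g^-1)%g * v x + w x * v x))).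
    rewrite mulr_sumr; apply: ler_sum => x _; rewrite powRr1 ?normc_ge0//.
    have -> : rdiff b g x = (u (x * g^-1)%g `^ r - u x `^ r)%:C%C.
      by rewrite rmorphB.
    rewrite normc_realc (le_trans (powR_dist _ _ _))// ?ltrDr//.
    rewrite ler_pM2l// {1}/r addrK -mulrDl ler_wpM2l ?addr_ge0 ?powR_ge0//.
    exact: ler_dist_normc.
  rewrite big_split /= -!mulrA ler_pM2l//; move: h1 h2; rewrite -/v; lra.
have {gradb} Db : (dpnorm S 1 b <= (L * (r * 2 * Num.sqrt N * e))%:E)%E.
  rewrite /dpnorm invr1 poweRe1; last first.
    by apply: sume_ge0 => g _; exact: poweR_ge0.
  rewrite mulr_suml -sumEFin big_seq [leRHS]big_seq; apply: lee_sum => g gS.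
  rewrite poweRe1 ?poweR_ge0// mul1r.
  have := lpnorm_le ltr01 (gradb g gS).
  by rewrite invr1 powRr1// !mulr_ge0 ?sqrtr_ge0 ?(ltW r0).
have := hC b fb; have d1 : 0 < d / (d - 1) by rewrite divr_gt0.
move=> /(le_trans (seq_le_lpnorm b d1 us1)) h.
have {h} := le_trans h (lee_wpmul2l _ Db); rewrite lee_fin (ltW C0) => /(_ isT).
rewrite -EFinM lee_fin (eq_bigr (fun x => u x `^ q)) -/N; last first.
  move=> x _; rewrite nb -powRrM; congr (_ `^ _).
  by rewrite /q /r /s; field; rewrite dn2 dn1.
(* The case N = 0 is set apart because sqrt(N) is cancelled below. *)
have [->|Nn0] := eqVneq N 0; first by rewrite powR_ge0.
have Ngt0 : 0 < N by rewrite lt_def Nn0.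
have -> : (d / (d - 1))^-1 = q^-1 + 2^-1.
  by rewrite /q; field; rewrite dn2 dn1 dn0.
rewrite powRD ?Nn0 ?implybT// powR12_sqrt//.
have -> : C * (L * (r * 2 * Num.sqrt N * e)) =
  C * L * (r * 2) * e * Num.sqrt N by ring.
rewrite ler_pM2r ?sqrtr_gt0// => h.
have -> : N = (N `^ q^-1) `^ q by rewrite -powRrM mulVf ?gt_eqF// powRr1.
by apply: ge0_ler_powR; rewrite ?nnegrE ?powR_ge0 ?(ltW q0)//
   !mulr_ge0 ?(ltW C0) ?(ltW r0).
Qed.

End Sobolev.

(** * Approximation by finitely supported functions in the D(2)-seminorm *)

Section Density.
Variables (R : realType) (G : groupType).
Implicit Types a b : G -> R[i].

(** Serves finite generating sets twice: with [T] the naturals for the ergodic thresholds, and with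
    [T] the reals for a common L^2 bound. *)
Lemma uniform_threshold (I : eqType) (s : seq I) disp (T : orderType disp)
    (t0 : T) (P : I -> T -> Prop) :
  (forall i, i \in s -> exists t, forall u, (t <= u)%O -> P i u) ->
  exists t, forall i, i \in s -> forall u, (t <= u)%O -> P i u.
Proof.
elim: s => [|i s IH] h; first by exists t0.
have [|t ht] := IH; first by move=> j js; apply: h; rewrite inE js orbT.
have [t' ht'] := h i (mem_head _ _).
exists (Order.max t t') => j; rewrite inE => /predU1P[->|js] u.
  by rewrite ge_max => /andP[_ /ht'].
by rewrite ge_max => /andP[/(ht j js)].
Qed.

Lemma L2_sum n (a : 'I_n -> G -> R[i]) : (forall k, Lp 2 (a k)) ->
  Lp 2 (fun x => \sum_(k < n) a k x).
Proof.
move=> aL; apply/L2P.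
elim: n a aL => [|n IH] a aL.
  exists 0 => // s us; rewrite big1 ?expr0n// => x _.
  by rewrite big_ord0 normc0 expr0n.
have [e e0 he] := IH (fun k => a (widen_ord (leqnSn n) k)) (fun k => aL _).
have [f f0 hf] := (L2P _).1 (aL ord_max).
exists (e + f); first exact: addr_ge0.
apply: l2_leS (l2_leD e0 f0 he hf) => x.
by rewrite normc_ge0 big_ord_recr ler_normcD.
Qed.

Lemma l2_le_rdiff a e g : 0 <= e -> l2_le (fun x => normc (a x)) e ->
  l2_le (fun x => normc (rdiff a g x)) (e + e).
Proof.
move=> e0 ae; apply: l2_leS (l2_leD e0 e0 (l2_le_rtrans g ae) ae) => x.
by rewrite normc_ge0 (le_trans (ler_normcD _ _))// normc_opp.
Qed.

(** The function [f], which is [b] minus its average over n translates by powers of [z], lies in L^2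
    and is within eps/2 of [b]; truncating [f] to a finite set costs another eps/2. *)
Lemma group_ring_dense (S : {fset G}) (z : G) b (eps : R) :
  central z -> infinite_order z -> (forall g, Lp 2 (rdiff b g)) -> 0 < eps ->
  exists2 a, group_ring a & forall g, g \in S ->
    l2_le (fun x => normc (rdiff (fun y => a y - b y) g x)) eps.
Proof.
move=> zC z_inf bL eps0.
have e20 : 0 < eps / 2 by rewrite divr_gt0.
have e40 : 0 < eps / 2 / 2 by rewrite divr_gt0.
have [n0 hn0] : exists n0 : nat, forall g, g \in S -> forall n, (n0 <= n)%O ->
    l2_le (fun x => normc (\sum_(k < n) rtrans (z ^+ k)%g (rdiff b g) x))
      (n%:R * (eps / 2)).
  apply: (uniform_threshold 0%N) => g _.
  have [e e0 be] := (L2P _).1 (bL g).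
  have [n0 hn0] := mean_ergodic z_inf e20 be.
  by exists n0.
(* The successor makes [n] invertible and keeps it above the threshold. *)
pose n := n0.+1; have nn0 : n%:R != 0 :> R[i] by rewrite pnatr_eq0.
(* Written through the cocycle values at z^k, whose membership in L^2 is known; [b] itself need not
   be in L^2. *)
pose f x := - (n%:R^-1 * \sum_(k < n) rdiff b (z ^+ k)%g x).
have [M fM] : exists M, sums_le (fun x => normc (f x) ^+ 2) M.
  have [e e0 he] := (L2P _).1 (L2_sum (fun k : 'I_n => bL (z ^+ k)%g)).
  exists ((n%:R^-1 * e) ^+ 2).
  suff : l2_le (fun x => normc (f x)) (n%:R^-1 * e) by [].
  apply: l2_leS (l2_leZ n%:R^-1 he) => x.
  by rewrite normc_ge0 /f normc_opp normcM normcV normc_nat /= lexx.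
(* Precision eps/4, since [rdiff] can double the L^2 norm. *)
have [s us fs] := L2_truncation e40 fM.
pose a x := if x \in s then f x else 0.
exists a.
  apply: (@sub_finite_set _ _ [set` s]%classic); last exact: finite_seq.
  by move=> x /=; rewrite /a; case: ifP => //; rewrite eqxx.
move=> g gS; have ng := hn0 g gS n (leqnSn n0).
have af : l2_le (fun x => normc (rdiff (fun y => f y - a y) g x)) (eps / 2).
  by rewrite [eps / 2]splitr; apply: l2_le_rdiff; rewrite ?ltW.
have fb : l2_le (fun x => normc (rdiff (fun y => f y - b y) g x)) (eps / 2).
  have -> : eps / 2 = n%:R^-1 * (n%:R * (eps / 2)).
    by rewrite mulKf// pnatr_eq0.
  apply: l2_leS (l2_leZ n%:R^-1 ng) => x.
  rewrite normc_ge0 -normc_nat -normcV -normcM -[leRHS]normc_opp.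
  rewrite le_eqVlt; apply/orP; left; apply/eqP; congr normc.
  have fbE y : f y - b y = - (n%:R^-1 * \sum_(k < n) rtrans (z ^+ k)%g b y).
    rewrite /f /rdiff big_split /= sumrN sumr_const card_ord.
    by rewrite -[b y *+ n]mulr_natl mulrBr mulKf// opprB addrAC subrr add0r.
  rewrite /rdiff {1}/rtrans !fbE -opprD -mulrBr -sumrB.
  congr (- (_ * _)); apply: eq_bigr => k _; rewrite /rtrans; congr (b _ - _).
  (* Centrality of [z] lets the translation by [g] pass through those by z^k, so that the difference
     of the average is the average of the differences. *)
  rewrite -!mulgA -!invgM; congr (_ * _^-1)%g.
  exact: esym (commuteX k (commute_sym (zC g))).
have e2 := ltW e20.
rewrite [eps]splitr; apply: l2_leS (l2_leD e2 e2 af fb) => x.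
rewrite normc_ge0 /= addrC -[X in _ + X]normc_opp.
rewrite (le_trans _ (ler_normcD _ _))//.
rewrite le_eqVlt; apply/orP; left; apply/eqP; congr normc.
by rewrite /rdiff /rtrans; ring.
Qed.

(** * Limits of Cauchy sequences with explicit rates *)

(** Every u n - e n lies below every u m + e m, so the supremum of the former lies in all the
    intervals. *)
Lemma cauchy_real_limit (u e : nat -> R) :
  (forall n m, `|u n - u m| <= e n + e m) ->
  exists l, forall n, `|u n - l| <= e n.
Proof.
move=> ue; pose E := [set u n - e n | n in [set: nat]]%classic.
have ubE m : ubound E (u m + e m).
  move=> _ [n _ <-]; have := ue n m; rewrite ler_norml => /andP[_]; lra.
have E0 : nonempty E by exists (u 0%N - e 0%N), 0%N.
have supE : has_sup E by split => //; exists (u 0%N + e 0%N); exact: ubE.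
exists (sup E) => n; have h1 := ge_sup E0 (ubE n).
have h2 : u n - e n <= sup E by apply: (sup_upper_bound supE); exists n.
by rewrite ler_norml; apply/andP; split; lra.
Qed.

(** Real and imaginary parts converge separately, each with error e n; hence the factor 2. *)
Lemma cauchy_complex_limit (u : nat -> R[i]) (e : nat -> R) :
  (forall n m, normc (u n - u m) <= e n + e m) ->
  exists l, forall n, normc (u n - l) <= 2 * e n.
Proof.
move=> ue.
have normRe (w : R[i]) : `|complex.Re w| <= normc w.
  by case: w => x y /=; rewrite -sqrtr_sqr ler_wsqrtr// lerDl sqr_ge0.
have normIm (w : R[i]) : `|complex.Im w| <= normc w.
  by case: w => x y /=; rewrite -sqrtr_sqr ler_wsqrtr// lerDr sqr_ge0.
have [|l hl] := @cauchy_real_limit (fun n => complex.Re (u n)) e.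
  by move=> n m; rewrite (le_trans _ (ue n m))// -raddfB normRe.
have [|l' hl'] := @cauchy_real_limit (fun n => complex.Im (u n)) e.
  by move=> n m; rewrite (le_trans _ (ue n m))// -raddfB normIm.
exists (Complex l l') => n.
have -> : u n - Complex l l' =
    Complex (complex.Re (u n) - l) 0 + Complex 0 (complex.Im (u n) - l').
  by case: (u n) => x y; simpc.
rewrite (le_trans (ler_normcD _ _))//= expr0n /= addr0 add0r !sqrtr_sqr.
by have := hl n; have := hl' n; lra.
Qed.

End Density.

(** * The representative in L^(2d/(d-2)) *)

Section Representative.
Variables (R : realType) (G : groupType) (S : {fset G}).
Implicit Types b : G -> R[i].

(** The elements [h] admitting such a bound form a subgroup containing [S]. The constant depends on
    [h] but not on [n], so decay of the differences along the generators passes to every group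
    element. *)
Lemma rdiff_generated (c : nat -> G -> R[i]) (e : nat -> R) :
  generates S ->
  (forall n g, g \in S -> forall x, normc (rdiff (c n) g x) <= e n) ->
  forall h, exists A, forall n x, normc (rdiff (c n) h x) <= A * e n.
Proof.
move=> Sgen ce h.
pose H : {pred G} := fun h =>
  `[< exists A, forall n x, normc (rdiff (c n) h x) <= A * e n >].
suff /asboolP : h \in H by [].
apply: Sgen; last first.
  by move=> g gS; apply/asboolP; exists 1 => n x; rewrite mul1r ce.
split=> [|u v /asboolP [A hA] /asboolP [B hB]]; apply/asboolP.
  by exists 0 => n x; rewrite /rdiff /rtrans invg1 mulg1 subrr normc0 mul0r.
exists (A + B) => n x.
have -> : rdiff (c n) (u / v)%g x =
    rdiff (c n) u (x * v)%g + - rdiff (c n) v (x * v)%g.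
  by rewrite /rdiff /rtrans invgM invgK mulgA mulgK; ring.
rewrite (le_trans (ler_normcD _ _))// normc_opp mulrDl lerD//.
Qed.

(** The approximants [a n] are bounded in L^q by the Sobolev inequality and, up to a constant,
    converge pointwise to [b]. A Fatou argument on finite sums then bounds the L^q norm of the
    limit. *)
Lemma D2_representative b (d : R) : generates S -> 2 < d ->
  (exists z : G, central z /\ infinite_order z) -> condition_S S d ->
  (forall g, Lp 2 (rdiff b g)) ->
  exists c : R[i], Lp (2 * d / (d - 2)) (fun x => b x + c).
Proof.
move=> Sgen d2 [z [zC z_inf]] hS bL.
have [K K0 sob] := Sobolev d2 hS.
set q := 2 * d / (d - 2) in sob *.
have d20 : 0 < d - 2 by rewrite subr_gt0.
have q1 : 1 < q by rewrite /q ltr_pdivlMr//; lra.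
have q0 : 0 < q by rewrite (lt_trans _ q1).
pose eps n : R := n.+1%:R^-1.
have eps0 n : 0 < eps n by rewrite invr_gt0.
have eps0' n : 0 <= eps n by rewrite ltW.
have eps1 n : eps n <= 1 by rewrite invf_le1// ler1n.
have /choice [a ha] : forall n, exists a, group_ring a /\
    forall g, g \in S ->
      l2_le (fun x => normc (rdiff (fun y => a y - b y) g x)) (eps n).
  by move=> n; have [a] := group_ring_dense S zC z_inf bL (eps0 n); exists a.
pose c n x := a n x - b x.
have ca n g : g \in S -> l2_le (fun x => normc (rdiff (c n) g x)) (eps n).
  by move=> gS; exact: (ha n).2.
have [D hD] : exists D, forall g, g \in S -> forall u, D <= u ->
    0 <= u /\ l2_le (fun x => normc (rdiff b g x)) u.
  apply: (uniform_threshold 0) => g _; have [e e0 he] := (L2P _).1 (bL g).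
  by exists e => u eu; split; [exact: le_trans eu|exact: l2_le_trans eu he].
pose E := `|D|.
have E0 : 0 <= E by exact: normr_ge0.
have bE g : g \in S -> l2_le (fun x => normc (rdiff b g x)) E.
  by move=> gS; have [] := hD g gS E (ler_norm _).
(* Along each generator the differences of [a n] have L^2 norm at most eps n + E <= 1 + E. *)
pose k := K * (1 + E).
have k0 : 0 <= k by rewrite mulr_ge0// addr_ge0.
have ak n : sums_le (fun x => normc (a n x) `^ q) (k `^ q).
  apply: sob; [exact: (ha n).1|exact: addr_ge0|move=> g gS].
  have := l2_leD ler01 E0 (l2_le_trans (eps0' n) (eps1 n) (ca n g gS)) (bE g gS).
  apply: l2_leS => x; rewrite normc_ge0 (le_trans _ (ler_normcD _ _))//.
  rewrite le_eqVlt; apply/orP; left; apply/eqP; congr normc.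
  by rewrite /rdiff /rtrans /c; ring.
have powR_le (u v : R) : 0 <= u -> 0 <= v -> u `^ q <= v `^ q -> u <= v.
  move=> u0 v0; rewrite !leNgt; apply: contraNN => vu.
  by apply: gt0_ltr_powR; rewrite ?nnegrE.
(* The Sobolev inequality for a n - a m, read at the single point 1, where b(1) cancels. *)
have cauchy n m : normc (c n 1%g - c m 1%g) <= K * eps n + K * eps m.
  have -> : c n 1%g - c m 1%g = a n 1%g - a m 1%g by rewrite /c; ring.
  rewrite -mulrDr; apply: powR_le; rewrite ?normc_ge0 ?mulr_ge0 ?addr_ge0//.
  have fnm : group_ring (fun x => a n x - a m x).
    apply: (@sub_finite_set _ _
      ([set x | a n x != 0] `|` [set x | a m x != 0])%classic).
      move=> x /=; have [->|] := eqVneq (a n x) 0; last by left.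
      by rewrite sub0r oppr_eq0; right.
    by rewrite finite_setU; split; [exact: (ha n).1|exact: (ha m).1].
  apply: (@sums_le_point _ _ (fun x => normc (a n x - a m x) `^ q)).
  apply: sob => // [|g gS]; first by rewrite addr_ge0.
  have := l2_leD (eps0' n) (eps0' m) (ca n g gS) (ca m g gS).
  apply: l2_leS => x; rewrite normc_ge0 -[X in _ + X]normc_opp.
  rewrite (le_trans _ (ler_normcD _ _))//.
  rewrite le_eqVlt; apply/orP; left; apply/eqP; congr normc.
  by rewrite /rdiff /rtrans /c; ring.
have [l hl] := cauchy_complex_limit cauchy.
(* Convergence spreads from 1 to x, since c n x - c n 1 is the difference of [c n] along x^-1 at 1.
   As c n = a n - b, this says that [a n] tends pointwise to b + l. *)
have cl x : exists B, forall n, normc (c n x - l) <= B * eps n.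
  have [||A hA] := @rdiff_generated c eps _ _ (x^-1)%g => //.
    by move=> n g gS y; apply: (l2_le_point y _ (ca n g gS)).
  exists (A + 2 * K) => n.
  have -> : c n x - l = rdiff (c n) (x^-1)%g 1%g + (c n 1%g - l).
    by rewrite /rdiff /rtrans invgK mul1g; ring.
  by rewrite (le_trans (ler_normcD _ _))// mulrDl lerD// -mulrA.
exists l; apply/(LpP _ q0); exists (k `^ q + 1) => s us.
have an_le n x : normc (a n x) <= k.
  by apply: powR_le; rewrite ?normc_ge0//; exact: (sums_le_point x (ak n)).
(* The q-th powers converge at each point at the rate O(eps n), with a constant depending on x only,
   because |a n x| <= k for all n. *)
have pw x : exists Y, forall n,
    normc (b x + l) `^ q <= normc (a n x) `^ q + Y * eps n.
  have [B hB] := cl x; pose v := normc (b x + l).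
  have v0 : 0 <= v by exact: normc_ge0.
  exists (q * ((v `^ (q - 1) + k `^ (q - 1)) * B)) => n.
  rewrite -/v -lerBlDl (le_trans (ler_norm _))//.
  rewrite (le_trans (powR_dist q1 v0 (normc_ge0 _)))// -mulrA ler_pM2l// -mulrA.
  apply: ler_pM => //; first by rewrite addr_ge0 ?powR_ge0.
    rewrite lerD2l; apply: ge0_ler_powR; rewrite ?nnegrE ?normc_ge0 ?an_le//.
    by rewrite subr_ge0 ltW.
  rewrite (le_trans (ler_dist_normc _ _))// normc_distC.
  by have := hB n; rewrite /c opprD addrA.
have /choice [Y hY] := pw.
pose Z := \sum_(x <- s) Y x.
(* The index is chosen after the finite set [s], so that the total error Z/(n+1) is at most 1; this
   is the 1 in the bound k^q + 1. *)
pose n := Num.truncn Z.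
have Zn : Z * eps n <= 1.
  by rewrite ler_pdivrMr// mul1r ltW ?truncnS_gt.
apply: (@le_trans _ _ (\sum_(x <- s) (normc (a n x) `^ q + Y x * eps n))).
  exact: ler_sum.
by rewrite big_split /= -mulr_suml lerD// ak.
Qed.

End Representative.

(** * From cohomology classes to functions *)

Theorem theorem6p3 (R : realType) (G : groupType) (S : {fset G})
    (Ssym : symmetric_fset S) (Sgen : generates S)
    (d : R) (d_gt2 : 2 < d)
    (hz : exists z : G, central z /\ infinite_order z)
    (hS : condition_S S d) :
  forall c, H1 R G c -> c <> B1 R G ->
    exists alpha : G -> R[i],
      [/\ Dp S 2 alpha, Lp (2 * d / (d - 2)) alpha & c = H1_of_D2 alpha].
Proof.
move=> _ [delta [dL dM] <-] _.
(* Every cocycle becomes a coboundary among all functions on [G]: the cocycle identity for g x^-1,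
   evaluated at 1, gives b(x g^-1) = delta(g)(x) + b(x). *)
pose b x := delta (x^-1)%g 1%g.
have bd g : rdiff b g = delta g.
  apply/funext => x; rewrite /rdiff /rtrans /b invgM invgK dM.
  by rewrite /rtrans mul1g invgK addrK.
have [l hl] : exists l : R[i], Lp (2 * d / (d - 2)) (fun x => b x + l).
  by apply: (D2_representative Sgen d_gt2 hz hS) => g; rewrite bd.
(* Adding a constant leaves the cocycle, hence the class, unchanged. *)
have bld g : rdiff (fun x => b x + l) g = delta g.
  by rewrite -bd; apply/funext => x; rewrite /rdiff /rtrans; ring.
exists (fun x => b x + l); split => //.
  by move=> g _; rewrite bld.
by rewrite /H1_of_D2; congr coh_class; apply/funext => g; rewrite bld.
Qed.
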